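(* Let $F=\langle W,R,I\rangle$ be an (8-4)-frame. Then $F$ is transitive through equality if and only if $$F\vDash\Box\varphi\to\blacksquare\blacksquare\varphi$$ (for every formula $\varphi$).
   Context: A frame $F=\langle W,R,I\rangle$ is transitive through equality when, for every $w,u,u'$ such that $I(w)=I(u)=I(u')$, $wRu$ and $uRu'$ imply $wRu'$. Formulas are built from a denumerable set $\mathrm{Var}$ of variables with unary $\neg,\Box,\circ,\blacksquare$ and binary $\wedge,\vee$; $\alpha\to\beta:=\neg\alpha\vee\beta$. (8-4)-semantics: let $B_8$ be the eight-element Boolean algebra (top $1$, bottom $0$, join $+$, meet $\cdot$, complement $-$), with $\circledcirc x=1$ if $x\in\{0,1\}$ and $\circledcirc x=0$ otherwise, and $U$ any fixed ultrafilter of $B_8$. Let $B_1,B_2,B_3$ be the three four-element Boolean subalgebras of $B_8$. An (8-4)-frame is $F=\langle W,R,I\rangle$ with $W\neq\emptyset$, $R\subseteq W\times W$, $I:W\to\{B_1,B_2,B_3\}$; write $L_w=I(w)$. A model $M$ based on $F$ adds a function $v$ with $v_w(p)=v(w,p)\in L_w$ for $w\in W$, $p\in\mathrm{Var}$. For $x\in B_8$ and $L'\in\{B_1,B_2,B_3\}$, $x^{L'}=\bigvee_{L'}\{y\in L'\mid y\leq x\}$. Each $v_w$ extends to formulas by $v_w(\neg\alpha)=-v_w(\alpha)$, $v_w(\alpha\vee\beta)=v_w(\alpha)+v_w(\beta)$, $v_w(\alpha\wedge\beta)=v_w(\alpha)\cdot v_w(\beta)$, $v_w(\circ\alpha)=\circledcirc(v_w(\alpha))$,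 $v_w(\Box\alpha)=\bigwedge_{L_w}\{(v_u(\alpha))^{L_w}\mid u\in W,\ wRu\}$, and $v_w(\blacksquare\alpha)=\bigwedge\{v_{w'}(\alpha)\mid I(w')=I(w)\text{ and }wRw'\}$ (empty meet equal to $1$). $M,w\vDash\varphi$ iff $v_w(\varphi)\in U\cap L_w$; $M\vDash\varphi$ iff $M,w\vDash\varphi$ for all $w\in W$; $F\vDash\varphi$ iff $M\vDash\varphi$ for every model $M$ based on $F$. *)

(* Defs.v *)
From mathcomp Require Import all_boot.
From mathcomp Require Import boolp.

Set Implicit Arguments.
Unset Strict Implicit.
Unset Printing Implicit Defensive.

(* The eight-element Boolean algebra, as the powerset of a three-element set:
   0 = set0, 1 = setT, + = :|:, . = :&:, - = ~:, <= is \subset. *)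
Definition B8 : finType := {set 'I_3}.

Definition circ8 (x : B8) : B8 :=
  if x \in [set set0; setT] then setT else set0.

Definition proper_filter (U : {set B8}) : bool :=
  [&& setT \in U, set0 \notin U,
      [forall x in U, forall y in U, x :&: y \in U]
    & [forall x in U, forall y : B8, (x \subset y) ==> (y \in U)]].

Definition ultrafilter (U : {set B8}) : bool := maxset proper_filter U.

Definition subalgebra (L : {set B8}) : bool :=
  [&& set0 \in L, setT \in L,
      [forall x in L, ~: x \in L],
      [forall x in L, forall y in L, x :|: y \in L]
    & [forall x in L, forall y in L, x :&: y \in L]].

(* The inhabitants of this type are exactly the three subalgebras
   {0, 1, a, -a}, one for each atom a of B8. *)
Definition subalg4 : finType := {L : {set B8} | subalgebra L && (#|L| == 4)}.

(* A subalgebra inherits its operations, so its (finite) infima and suprema are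
   those of B8. S is an arbitrary set of values, indexed by a possibly infinite
   set of worlds; the empty meet is setT. *)
Definition meet8 (S : B8 -> Prop) : B8 := \bigcap_(y : B8 | `[< S y >]) y.

Definition lower (L : {set B8}) (x : B8) : B8 :=
  \bigcup_(y in L | y \subset x) y.

Definition var := nat.

Inductive formula : Type :=
| Var of var
| Neg of formula
| Box of formula
| Circ of formula
| BBox of formula
| And of formula & formula
| Or of formula & formula.

Definition Imp (a b : formula) : formula := Or (Neg a) b.

Record frame : Type := Frame {
  world : Type;
  world_inhabited : inhabited world;
  acc : world -> world -> Prop;
  lat : world -> subalg4
}.

Definition latset (F : frame) (w : world F) : {set B8} := sval (lat w).

Record model (F : frame) : Type := Model {
  val_var : world F -> var -> B8;
  val_var_lat : forall w p, val_var w p \in latset w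
}.

Fixpoint value (F : frame) (M : model F) (a : formula) (w : world F) : B8 :=
  match a with
  | Var p => val_var M w p
  | Neg b => ~: value M b w
  | Or b c => value M b w :|: value M c w
  | And b c => value M b w :&: value M c w
  | Circ b => circ8 (value M b w)
  | Box b => meet8 (fun y =>
      exists2 u, acc w u & y = lower (latset w) (value M b u))
  | BBox b => meet8 (fun y =>
      exists2 u, lat u = lat w /\ acc w u & y = value M b u)
  end.

Definition sat (U : {set B8}) (F : frame) (M : model F) (w : world F)
    (a : formula) : Prop :=
  value M a w \in U :&: latset w.

Definition model_valid (U : {set B8}) (F : frame) (M : model F)
    (a : formula) : Prop :=
  forall w : world F, sat U M w a.

Definition frame_valid (U : {set B8}) (F : frame) (a : formula) : Prop :=
  forall M : model F, model_valid U M a.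

Definition transitive_through_equality (F : frame) : Prop :=
  forall w u u' : world F, lat w = lat u -> lat u = lat u' ->
    acc w u -> acc u u' -> acc w u'.

(* Main.v *)
Require Import Defs.
From mathcomp Require Import all_boot.
From mathcomp Require Import boolp.

(** Since the lower approximation of [x] in a subalgebra lies below [x], the
    value of [Box phi] at [w] is below the value of [phi] at every successor
    of [w].  The value of [BBox (BBox phi)] at [w] is the meet of the values of
    [phi] at the endpoints of two-step paths whose worlds all carry the
    subalgebra of [w]; transitivity through equality makes these endpoints
    successors of [w], so the implication takes the value 1 everywhere.

    Conversely, if such a path leads from [w] to [u'] but [u'] is not a
    successor of [w], give a variable the value 0 at [u'] and 1 elsewhere.
    These two values belong to every subalgebra, so this is a model; at [w] it
    gives [Box] the value 1 and [BBox BBox] the value 0, so the implication has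
    the value 0, which lies in no proper filter. *)

Lemma meet8_sub (S : B8 -> Prop) (y : B8) : S y -> meet8 S \subset y.
Proof. by move=> Sy; apply: bigcap_inf; apply/asboolP. Qed.

Lemma sub_meet8 (S : B8 -> Prop) (x : B8) :
  (forall y, S y -> x \subset y) -> x \subset meet8 S.
Proof. by move=> xS; apply/bigcapsP => y /asboolP /xS. Qed.

Lemma lower_sub (L : {set B8}) (x : B8) : lower L x \subset x.
Proof. by apply/bigcupsP => y /andP[]. Qed.

Lemma lower_setT (L : {set B8}) : setT \in L -> lower L setT = setT.
Proof.
move=> LT; apply/eqP; rewrite -subTset.
by apply: (bigcup_sup (setT : B8)); rewrite LT subxx.
Qed.

Lemma set0_latset (F : frame) (w : world F) : set0 \in latset w.
Proof. by rewrite /latset; case: (lat w) => L /= /andP[/and5P[]]. Qed.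

Lemma setT_latset (F : frame) (w : world F) : setT \in latset w.
Proof. by rewrite /latset; case: (lat w) => L /= /andP[/and5P[]]. Qed.

Lemma ultrafilter_setT (U : {set B8}) : ultrafilter U -> setT \in U.
Proof. by move/maxsetp => /and4P[]. Qed.

Lemma ultrafilter_set0 (U : {set B8}) : ultrafilter U -> set0 \notin U.
Proof. by move/maxsetp => /and4P[]. Qed.

Lemma sat_Imp_of_sub (U : {set B8}) (F : frame) (M : model F) (w : world F)
    (a b : formula) :
  ultrafilter U -> value M a w \subset value M b w -> sat U M w (Imp a b).
Proof.
move=> hU ab; rewrite /sat /=.
have -> : ~: value M a w :|: value M b w = setT.
  by apply/eqP; rewrite -subTset -(setUCr (value M a w)) setUC setUS.
by rewrite inE ultrafilter_setT // setT_latset.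
Qed.

Lemma value_Box_sub (F : frame) (M : model F) (a : formula) (w u : world F) :
  acc w u -> value M (Box a) w \subset value M a u.
Proof.
move=> wu; apply: subset_trans (lower_sub (latset w) _).
by apply: meet8_sub; exists u.
Qed.

Definition indicator_val (F : frame) (P : world F -> Prop) (w : world F)
  (_ : var) : B8 := if `[< P w >] then setT else set0.

Lemma indicator_val_lat (F : frame) (P : world F -> Prop) (w : world F)
  (p : var) : indicator_val F P w p \in latset w.
Proof.
by rewrite /indicator_val; case: ifP; rewrite ?setT_latset ?set0_latset.
Qed.

(** Any two-valued valuation is admissible on every frame, because 0 and 1 lie
    in every subalgebra. *)
Definition indicator_model (F : frame) (P : world F -> Prop) : model F :=
  @Model F (indicator_val F P) (indicator_val_lat F P).

Theorem theorem5p10 (U : {set B8}) (hU : ultrafilter U) (F : frame) :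
  transitive_through_equality F <->
  (forall phi : formula, frame_valid U F (Imp (Box phi) (BBox (BBox phi)))).
Proof.
split=> [trF phi M w | valid w u u' lwu luu' wu uu'].
  apply: sat_Imp_of_sub => //.
  apply: sub_meet8 => _ [u [lu wu] ->].
  apply: sub_meet8 => _ [u' [lu' uu'] ->].
  by apply: value_Box_sub; apply: trF wu uu'.
apply: contrapT => nwu'.
pose M := indicator_model F (fun x => x <> u').
have Mu' : value M (Var 0) u' = set0.
  by rewrite /= /indicator_val asboolF //; apply.
have box1 : value M (Box (Var 0)) w = setT.
  apply/eqP; rewrite -subTset; apply: sub_meet8 => _ [x wx ->].
  rewrite /= /indicator_val asboolT; first by rewrite lower_setT ?setT_latset.
  by move=> xu'; apply: nwu'; rewrite -xu'.
have bbox0 : value M (BBox (BBox (Var 0))) w = set0.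
  apply/eqP; rewrite -subset0 -Mu'.
  apply: (@subset_trans _ _ (mem (value M (BBox (Var 0)) u))).
    by apply: meet8_sub; exists u.
  by apply: meet8_sub; exists u'.
have := valid (Var 0) M w; rewrite /sat inE => /andP[+ _].
rewrite -[value _ _ _]/(~: value M (Box (Var 0)) w :|:
  value M (BBox (BBox (Var 0))) w) box1 bbox0 setCT setU0.
exact/negP/ultrafilter_set0.
Qed.
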